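(* Let $T:\mathbb{R}^{n\times n}\to\Sigma_{(s)}^{[r]}$ be a tail projection for $\Sigma_{(s)}^{[r]}$ with constant $C_T\ge1$, and let $H:\mathbb{R}^{n\times n}\to\Sigma_{(s')}^{[r']}$ be a head projection for $\Sigma_{(2s)}^{[2r]}$ into $\Sigma_{(s')}^{[r']}$ with constant $c_H\le1$ which additionally takes the form $$H(\mathbf{M})=P^{[r']}(\mathbf{M}_{S'\times S'})\qquad\text{for some index set }S'\text{ (depending on }\mathbf{M})\text{ of size }s'.$$ Let $\mathcal{A}:\mathbb{R}^{n\times n}\to\mathbb{R}^m$ be a linear map. If $(1+C_T)^2(1-c_H^2)<1$ and if the restricted isometry property $$(1-\delta)\|\mathbf{Z}\|_F^2\le\|\mathcal{A}(\mathbf{Z})\|_2^2\le(1+\delta)\|\mathbf{Z}\|_F^2\qquad\text{for all }\mathbf{Z}\in\Sigma_{(2s+s')}^{[2r+r']}$$ holds with constant $\delta>0$ small enough to have $$\rho:=(1+C_T)^2\big(1-c_H^2(1-\delta)^2+2\delta(1+\delta)\big)<1,$$ then any $\mathbf{X}\in\Sigma_{(s)}^{[r]}$ acquired from $\mathbf{y}=\mathcal{A}(\mathbf{X})$ is recovered as the limit of the sequence $(\mathbf{X}_k)_{k\ge0}$ defined (from any initial matrix $\mathbf{X}_0\in\mathbb{R}^{n\times n}$) by $$\mathbf{X}_{k+1}=T\big[\mathbf{X}_k+H\big(\mathcal{A}^*(\mathbf{y}-\mathcal{A}(\mathbf{X}_k))\big)\big].$$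
   Context: For integers $r,s\ge1$: $\Sigma^{[r]}$ is the set of symmetric matrices in $\mathbb{R}^{n\times n}$ of rank at most $r$; $\Sigma_{(s)}$ is the set of symmetric matrices in $\mathbb{R}^{n\times n}$ whose entries vanish outside $S\times S$ for some index set $S\subseteq\{1,\ldots,n\}$ of size $s$ (all symmetric matrices if $s\ge n$); $\Sigma_{(s)}^{[r]}=\Sigma^{[r]}\cap\Sigma_{(s)}$. $\mathbf{M}_{S\times S}\in\mathbb{R}^{n\times n}$ agrees with $\mathbf{M}$ on $S\times S$ and is zero elsewhere. For a set $\Sigma$ among these, $P_\Sigma$ denotes the operator of best approximation from $\Sigma$ in Frobenius norm (some fixed choice if the best approximation is not unique), and $P^{[r]}=P_{\Sigma^{[r]}}$ (best approximation by symmetric matrices of rank at most $r$). $\mathcal{A}^*$ is the adjoint of $\mathcal{A}$ with respect to the Frobenius inner product on $\mathbb{R}^{n\times n}$ and the Euclidean inner product on $\mathbb{R}^m$. A tail projection for $\Sigma$ with constant $C_T\ge1$ is an operator $T:\mathbb{R}^{n\times n}\to\Sigma$ with $\|\mathbf{M}-T(\mathbf{M})\|_F\le C_T\|\mathbf{M}-P_\Sigma(\mathbf{M})\|_F$ for all $\mathbf{M}\in\mathbb{R}^{n\times n}$. A head projection for $\Sigma$ into $\Sigma'\supseteq\Sigma$ with constant $c_H\le1$ ($c_H>0$) is an operator $H:\mathbb{R}^{n\times n}\to\Sigma'$ with $\|H(\mathbf{M})\|_F\ge c_H\|P_\Sigma(\mathbf{M})\|_F$ for all $\mathbf{M}\in\mathbb{R}^{n\times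 n}$. *)

(* Defs.v *)
From HB Require Import structures.
From mathcomp Require Import all_boot all_order all_algebra.
From mathcomp Require Import all_classical all_reals all_analysis.

Set Implicit Arguments.
Unset Strict Implicit.
Unset Printing Implicit Defensive.

Import Order.TTheory GRing.Theory Num.Theory.

Local Open Scope classical_set_scope.
Local Open Scope ring_scope.

(* For column vectors this is the Euclidean inner product. *)
Definition frob_inner (R : realType) (p q : nat) (M N : 'M[R]_(p, q)) : R :=
  \sum_(i < p) \sum_(j < q) M i j * N i j.

Definition frob_norm (R : realType) (p q : nat) (M : 'M[R]_(p, q)) : R :=
  Num.sqrt (frob_inner M M).

Definition is_adjoint (R : realType) (n m : nat)
    (A : 'M[R]_n -> 'cV[R]_m) (Astar : 'cV[R]_m -> 'M[R]_n) : Prop :=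
  forall (M : 'M[R]_n) (u : 'cV[R]_m),
    frob_inner M (Astar u) = frob_inner (A M) u.

(* Index sets "of size s" are capped at the full index set: when s >= n the
   only one is [set: 'I_n], and [sparse s] is all symmetric matrices. *)
Definition index_set_of_size (n s : nat) (S : {set 'I_n}) : bool :=
  #|S| == minn s n.

(* M_{S x S}, kept at size n x n. *)
Definition block (R : realType) (n : nat) (S : {set 'I_n}) (M : 'M[R]_n) :
    'M[R]_n :=
  \matrix_(i, j) (if (i \in S) && (j \in S) then M i j else 0).

Definition lowrank (R : realType) (n r : nat) : set 'M[R]_n :=
  [set M | M \is symmetricmx /\ (\rank M <= r)%N].

Definition sparse (R : realType) (n s : nat) : set 'M[R]_n :=
  [set M | M \is symmetricmx /\
    exists2 S : {set 'I_n}, index_set_of_size s S & block S M = M].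

Definition sparse_lowrank (R : realType) (n s r : nat) : set 'M[R]_n :=
  lowrank r `&` sparse s.

(* [P] is one fixed choice of a best approximation from [Sigma]: minimizers
   need not be unique, and nothing is assumed on how ties are broken. *)
Definition best_approx_operator (R : realType) (n : nat)
    (Sigma : set 'M[R]_n) (P : 'M[R]_n -> 'M[R]_n) : Prop :=
  forall M : 'M[R]_n, Sigma (P M) /\
    forall N : 'M[R]_n, Sigma N -> frob_norm (M - P M) <= frob_norm (M - N).

Definition tail_projection (R : realType) (n : nat)
    (Sigma : set 'M[R]_n) (P : 'M[R]_n -> 'M[R]_n)
    (CT : R) (T : 'M[R]_n -> 'M[R]_n) : Prop :=
  [/\ 1 <= CT,
      forall M, Sigma (T M) &
      forall M, frob_norm (M - T M) <= CT * frob_norm (M - P M)].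

Definition head_projection (R : realType) (n : nat)
    (Sigma Sigma' : set 'M[R]_n) (P : 'M[R]_n -> 'M[R]_n)
    (cH : R) (H : 'M[R]_n -> 'M[R]_n) : Prop :=
  [/\ Sigma `<=` Sigma',
      0 < cH <= 1,
      forall M, Sigma' (H M) &
      forall M, cH * frob_norm (P M) <= frob_norm (H M)].

Definition restricted_isometry (R : realType) (n m : nat)
    (Sigma : set 'M[R]_n) (A : 'M[R]_n -> 'cV[R]_m) (delta : R) : Prop :=
  forall Z : 'M[R]_n, Sigma Z ->
    (1 - delta) * frob_norm Z ^+ 2 <= frob_norm (A Z) ^+ 2
      <= (1 + delta) * frob_norm Z ^+ 2.

(* Main.v *)
(** Write [E = X - X_k] and [G = A^* A E], and let [<.,.>] be the Frobenius
    inner product.  Both [P^[r']] and [P_Sigma] project onto cones, so a best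
    approximation [P M] satisfies [<M, P M> = |P M|^2] and
    [<M, N> <= |P M| |N|] on the cone.  As [H G] is moreover supported on the
    block [S'], it follows that [<G, H G> = |H G|^2], that is
    [<A E, A (H G)> = |H G|^2].  Polarizing the restricted isometry property
    turns this into [<E, H G> >= |H G|^2 - delta |E| |H G|] and
    [|H G| <= (1 + delta) |E|], while the head property gives
    [|H G| >= cH (1 - delta) |E|].  Expanding [|E - H G|^2] and using the
    near-optimality of [T] yields [|X - X_{k+1}|^2 <= rho |X - X_k|^2] as soon
    as [X_k] lies in the model set, i.e. for [k >= 1]. *)

Require Import Defs.
From HB Require Import structures.
From mathcomp Require Import all_boot all_order all_algebra.
From mathcomp Require Import all_classical all_reals all_analysis.
From mathcomp Require Import ring lra zify.

Import Order.TTheory GRing.Theory Num.Theory.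
Import numFieldNormedType.Exports.

Local Open Scope classical_set_scope.
Local Open Scope ring_scope.

Set Implicit Arguments.
Unset Strict Implicit.

(** * Frobenius inner product and norm *)

Section FrobeniusInner.
Variables (R : realType) (p q : nat).
Implicit Types M N U V : 'M[R]_(p, q).

Lemma frob_innerC M N : frob_inner M N = frob_inner N M.
Proof. by do 2!(apply: eq_bigr => ? _); rewrite mulrC. Qed.

Lemma frob_innerDl M N U :
  frob_inner (M + N) U = frob_inner M U + frob_inner N U.
Proof.
rewrite /frob_inner -big_split; apply: eq_bigr => i _.
by rewrite -big_split; apply: eq_bigr => j _; rewrite mxE mulrDl.
Qed.

Lemma frob_innerZl a M N : frob_inner (a *: M) N = a * frob_inner M N.
Proof.
rewrite /frob_inner mulr_sumr; apply: eq_bigr => i _.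
by rewrite mulr_sumr; apply: eq_bigr => j _; rewrite mxE mulrA.
Qed.

Lemma frob_innerNl M N : frob_inner (- M) N = - frob_inner M N.
Proof. by rewrite -scaleN1r frob_innerZl mulN1r. Qed.

Lemma frob_inner0l M : frob_inner 0 M = 0.
Proof. by rewrite -(scale0r M) frob_innerZl mul0r. Qed.

Lemma frob_innerDr M N U :
  frob_inner U (M + N) = frob_inner U M + frob_inner U N.
Proof. by rewrite !(frob_innerC U) frob_innerDl. Qed.

Lemma frob_innerZr a M N : frob_inner M (a *: N) = a * frob_inner M N.
Proof. by rewrite !(frob_innerC M) frob_innerZl. Qed.

Lemma frob_innerNr M N : frob_inner M (- N) = - frob_inner M N.
Proof. by rewrite !(frob_innerC M) frob_innerNl. Qed.

Lemma frob_inner_sqB M N :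
  frob_inner (M - N) (M - N) =
  frob_inner M M - 2 * frob_inner M N + frob_inner N N.
Proof.
rewrite frob_innerDl !frob_innerDr !frob_innerNl !frob_innerNr.
by rewrite (frob_innerC N M); ring.
Qed.

Lemma frob_inner_sqL a b M N :
  frob_inner (a *: M + b *: N) (a *: M + b *: N) =
  a ^+ 2 * frob_inner M M + 2 * a * b * frob_inner M N + b ^+ 2 * frob_inner N N.
Proof.
rewrite frob_innerDl !frob_innerDr !frob_innerZl !frob_innerZr.
by rewrite (frob_innerC N M); ring.
Qed.

Lemma frob_inner_ge0 M : 0 <= frob_inner M M.
Proof. by do 2!(apply: sumr_ge0 => ? _); rewrite -expr2 sqr_ge0. Qed.

Lemma frob_inner_ge_entry M i j : M i j ^+ 2 <= frob_inner M M.
Proof.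
rewrite /frob_inner (bigD1 i) //= (bigD1 j) //= -expr2 -addrA lerDl addr_ge0 //.
  by apply: sumr_ge0 => ? _; rewrite -expr2 sqr_ge0.
by do 2!(apply: sumr_ge0 => ? _); rewrite -expr2 sqr_ge0.
Qed.

Lemma frob_norm_ge0 M : 0 <= frob_norm M.
Proof. exact: sqrtr_ge0. Qed.

Lemma frob_norm_sq M : frob_norm M ^+ 2 = frob_inner M M.
Proof. by rewrite sqr_sqrtr ?frob_inner_ge0. Qed.

Lemma frob_norm_eq0 M : frob_norm M = 0 -> M = 0.
Proof.
move=> M0; apply/matrixP => i j; apply/eqP.
have := frob_inner_ge_entry M i j.
by rewrite -frob_norm_sq M0 expr0n /= exprn_even_le0 //= mxE.
Qed.

Lemma frob_normN M : frob_norm (- M) = frob_norm M.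
Proof. by rewrite /frob_norm frob_innerNl frob_innerNr opprK. Qed.

End FrobeniusInner.

(** * Polarized isometry bounds and the Cauchy-Schwarz inequality *)

Section Polarization.
Variables (R : realType) (n m : nat).
Implicit Types U V : 'M[R]_n.

(** Comparing the isometry bounds at |V| U + |U| V and |V| U - |U| V cancels |A U| and |A V|; these
    weights give both terms the same norm. As [Sigma] is in general not a subspace, it is asked to
    contain the span of [U] and [V]. *)
Lemma restricted_isometry_polar (Sigma : set 'M[R]_n)
    (A : {linear 'M[R]_n -> 'cV[R]_m}) (delta : R) U V :
  restricted_isometry Sigma A delta ->
  (forall a b : R, Sigma (a *: U + b *: V)) ->
  `|frob_inner (A U) (A V) - frob_inner U V| <=
    delta * (frob_norm U * frob_norm V).
Proof.
move=> rip UV.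
have [/frob_norm_eq0 ->|U0] := eqVneq (frob_norm U) 0.
  by rewrite linear0 !frob_inner0l subrr normr0 /frob_norm frob_inner0l
    sqrtr0 mul0r mulr0.
have [/frob_norm_eq0 ->|V0] := eqVneq (frob_norm V) 0.
  by rewrite linear0 !(frob_innerC _ 0) !frob_inner0l subrr normr0 /frob_norm
    frob_inner0l sqrtr0 !mulr0.
have u0 : 0 < frob_norm U by rewrite lt_def U0 frob_norm_ge0.
have v0 : 0 < frob_norm V by rewrite lt_def V0 frob_norm_ge0.
have uv0 := mulr_gt0 u0 v0.
have := rip _ (UV (frob_norm V) (frob_norm U)).
have := rip _ (UV (frob_norm V) (- frob_norm U)).
rewrite !linearD !linearZ !frob_norm_sq !frob_inner_sqL -!frob_norm_sq.
move: (frob_norm U) (frob_norm V) (frob_norm (A U)) (frob_norm (A V))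
  (frob_inner U V) (frob_inner (A U) (A V)) u0 v0 uv0 => u v x y w z u0 v0 uv0.
move=> /andP[lb1 ub1] /andP[lb2 ub2].
rewrite ler_norml; apply/andP; split; rewrite -(ler_pM2l uv0); lra.
Qed.

(* Polarization for the zero map, whose isometry constant is 1. *)
Lemma frob_cauchy_schwarz U V : `|frob_inner U V| <= frob_norm U * frob_norm V.
Proof.
rewrite -[leRHS]mul1r -normrN -sub0r.
pose A : {linear 'M[R]_n -> 'cV[R]_m} := \0.
rewrite -[X in X - _](frob_inner0l (A V)).
apply: (@restricted_isometry_polar setT A) => // Z _.
rewrite subrr mul0r sqr_ge0 /frob_norm frob_inner0l sqrtr0 expr0n /=.
by rewrite mulr_ge0 ?sqr_ge0 // addr_ge0.
Qed.

End Polarization.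

Lemma ler_frob_normD (R : realType) (n : nat) (U V : 'M[R]_n) :
  frob_norm (U + V) <= frob_norm U + frob_norm V.
Proof.
rewrite -(@ler_pXn2r _ 2) ?nnegrE ?addr_ge0 ?frob_norm_ge0 //.
rewrite frob_norm_sq -[U]scale1r -[V]scale1r frob_inner_sqL !scale1r sqrrD.
rewrite !frob_norm_sq.
(* The argument [0] is the codomain dimension of the auxiliary zero map; any value would do. *)
have := le_trans (ler_norm _) (@frob_cauchy_schwarz R n 0 U V).
by lra.
Qed.

(** * Best approximation from cones *)

Section Cones.
Variables (R : realType) (n : nat) (Sigma : set 'M[R]_n) (P : 'M[R]_n -> 'M[R]_n).
Hypothesis PP : best_approx_operator Sigma P.
Implicit Types M N : 'M[R]_n.

Lemma best_approx_sq M N : Sigma N ->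
  frob_inner (M - P M) (M - P M) <= frob_inner (M - N) (M - N).
Proof.
move=> SN; rewrite -!frob_norm_sq lerXn2r ?nnegrE ?frob_norm_ge0 //.
by have [_ ->] := PP M.
Qed.

Hypothesis SigmaZ : forall (a : R) M, Sigma M -> Sigma (a *: M).

(** The point [t *: P M] closest to [M] on the line through [P M] stays in the cone, so optimality
    of [P M] forces [t = 1]. *)
Lemma best_approx_cone M : frob_inner M (P M) = frob_inner (P M) (P M).
Proof.
have [SPM _] := PP M.
have [/frob_norm_eq0 ->|h0] := eqVneq (frob_norm (P M)) 0.
  by rewrite frob_innerC !frob_inner0l.
have {}h0 : 0 < frob_inner (P M) (P M).
  by rewrite -frob_norm_sq exprn_gt0 // lt_def h0 frob_norm_ge0.
pose t := frob_inner M (P M) / frob_inner (P M) (P M).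
have tE : t * frob_inner (P M) (P M) = frob_inner M (P M).
  by rewrite /t divfK ?gt_eqF.
have := best_approx_sq M (SigmaZ t SPM).
rewrite !frob_inner_sqB frob_innerZr frob_innerZl frob_innerZr -tE.
move: (frob_inner _ _) h0 (frob_inner M M) t {tE} => h h0 c t le.
suff /eqP : (t - 1) ^+ 2 * h = 0.
  by rewrite mulf_eq0 (gt_eqF h0) orbF sqrf_eq0 subr_eq0 => /eqP->; rewrite mul1r.
apply/eqP; rewrite eq_le; apply/andP; split; first by nra.
by rewrite mulr_ge0 ?sqr_ge0 // ltW.
Qed.

(** [P M] does at least as well as the orthogonal projection of [M] onto the line of [N]: |M|^2 - |P
    M|^2 <= |M|^2 - <M, N>^2 / |N|^2. *)
Lemma best_approx_inner_le M N : Sigma N ->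
  frob_inner M N <= frob_norm (P M) * frob_norm N.
Proof.
move=> SN.
have [/frob_norm_eq0 ->|h0] := eqVneq (frob_norm N) 0.
  by rewrite frob_innerC /frob_norm !frob_inner0l sqrtr0 mulr0.
have {}h0 : 0 < frob_inner N N.
  by rewrite -frob_norm_sq exprn_gt0 // lt_def h0 frob_norm_ge0.
pose t := frob_inner M N / frob_inner N N.
have tE : t * frob_inner N N = frob_inner M N by rewrite /t divfK ?gt_eqF.
have := best_approx_sq M (SigmaZ t SN).
rewrite !frob_inner_sqB frob_innerZr frob_innerZl frob_innerZr best_approx_cone.
move=> le; apply: (le_trans (ler_norm _)).
rewrite -(@ler_pXn2r _ 2) ?nnegrE ?mulr_ge0 ?frob_norm_ge0 //.
rewrite real_normK ?num_real // exprMn !frob_norm_sq; nra.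
Qed.

End Cones.

(** * Sparse and low-rank symmetric matrices *)

Section SymmetricMatrices.
Variables (R : realType) (n : nat).
Implicit Types (M N : 'M[R]_n) (S : {set 'I_n}).

Lemma symmetricmxP M : reflect (forall i j, M i j = M j i) (M \is symmetricmx).
Proof.
apply: (iffP (is_hermitianmxP _ _ _)); rewrite expr0 scale1r => symM.
  by move=> i j; rewrite [in LHS]symM !mxE.
by apply/matrixP => i j; rewrite !mxE symM.
Qed.

Lemma symmetricmxL (a b : R) M N :
  M \is symmetricmx -> N \is symmetricmx -> a *: M + b *: N \is symmetricmx.
Proof.
move=> /symmetricmxP sM /symmetricmxP sN; apply/symmetricmxP => i j.
by rewrite !mxE sM sN.
Qed.

Lemma block_mulmx S M :
  let D := diag_mx (\row_i (i \in S)%:R) in block S M = D *m M *m D.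
Proof.
apply/matrixP => i j; rewrite mul_mx_diag mul_diag_mx !mxE.
by do 2!case: (_ \in S); rewrite /= ?(mul0r, mulr0, mul1r, mulr1).
Qed.

Lemma rank_block S M : (\rank (block S M) <= \rank M)%N.
Proof. by rewrite block_mulmx (leq_trans (mxrankM_maxl _ _)) // mxrankM_maxr. Qed.

Lemma symmetric_block S M : M \is symmetricmx -> block S M \is symmetricmx.
Proof.
by move=> /symmetricmxP sM; apply/symmetricmxP => i j; rewrite !mxE andbC sM.
Qed.

Lemma block_subset S S' M : S \subset S' -> block S M = M -> block S' M = M.
Proof.
move=> /fintype.subsetP SS' bM; apply/matrixP => i j; rewrite -bM !mxE.
case: (boolP ((i \in S) && _)) => [/andP[iS jS]|_]; last by rewrite if_same.
by rewrite (SS' _ iS) (SS' _ jS).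
Qed.

Lemma blockL S (a b : R) M N :
  block S (a *: M + b *: N) = a *: block S M + b *: block S N.
Proof.
by apply/matrixP => i j; rewrite !mxE; case: ifP; rewrite ?mulr0 ?addr0.
Qed.

Lemma frob_inner_block S M N :
  frob_inner (block S M) N = frob_inner M (block S N).
Proof.
by do 2!(apply: eq_bigr => ? _); rewrite !mxE; case: ifP; rewrite ?mul0r ?mulr0.
Qed.

Lemma superset_of_card S k : (#|S| <= k <= n)%N ->
  exists2 S' : {set 'I_n}, S \subset S' & #|S'| = k.
Proof.
elim: k => [|k IH] /andP[]; first by rewrite leqn0 => /eqP; exists S.
rewrite leq_eqVlt => /predU1P[|Sk kn]; first by exists S.
have [|S' SS' cS'] := IH; first by rewrite -ltnS Sk ltnW.
have /card_gt0P[x] : (0 < #|~: S'|)%N.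
  by rewrite cardsCs finset.setCK card_ord; lia.
rewrite inE => xS'; exists (x |: S'); last by rewrite cardsU1 xS' cS'.
by rewrite (fintype.subset_trans SS') // finset.subsetUr.
Qed.

(** Padding a support up to size [minn s n] is harmless, so an upper bound on its size suffices.
    This form suits unions of supports. *)
Lemma sparseE s M : sparse s M <->
  M \is symmetricmx /\ exists2 S : {set 'I_n}, (#|S| <= s)%N & block S M = M.
Proof.
split=> -[sM [S cS bM]]; split=> //.
  by exists S => //; rewrite (eqP cS) geq_minl.
have [|S' SS' cS'] := @superset_of_card S (minn s n).
  by rewrite geq_minr leq_min cS -[X in (_ <= X)%N]card_ord max_card.
by exists S'; [exact/eqP|exact: block_subset bM].
Qed.

(** Ranks add up and supports are united; this produces the parameters [2 * s] and [2 * s + s']. *)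
Lemma sparse_lowrankL s1 r1 s2 r2 (a b : R) M N :
  sparse_lowrank s1 r1 M -> sparse_lowrank s2 r2 N ->
  sparse_lowrank (s1 + s2) (r1 + r2) (a *: M + b *: N).
Proof.
move=> [[sM rM] /sparseE[_ [S1 c1 b1]]] [[sN rN] /sparseE[_ [S2 c2 b2]]].
split; first split; first exact: symmetricmxL.
  apply: leq_trans (mxrank_add _ _) _.
  by apply: leq_add; apply: leq_trans (mxrank_scale _ _) _.
apply/sparseE; split; first exact: symmetricmxL.
exists (S1 :|: S2); first by rewrite cardsU (leq_trans (leq_subr _ _)) ?leq_add.
rewrite blockL (block_subset _ b1) ?finset.subsetUl //.
by rewrite (block_subset _ b2) ?finset.subsetUr.
Qed.

Lemma sparse_lowrankZ s r (a : R) M :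
  sparse_lowrank s r M -> sparse_lowrank s r (a *: M).
Proof.
(* Adding the zero matrix, of support size and rank 0, reduces scaling to linear combinations
   without raising [s] or [r]. *)
move=> HM; have M0 : sparse_lowrank 0 0 (0 : 'M[R]_n).
  have s0 : (0 : 'M[R]_n) \is symmetricmx.
    by apply/symmetricmxP => i j; rewrite !mxE.
  split; first by split=> //; rewrite mxrank0.
  apply/sparseE; split=> //; exists finset.set0; rewrite ?cards0 //.
  by apply/matrixP => i j; rewrite !mxE if_same.
have := sparse_lowrankL a 0 HM M0.
by rewrite !addn0 scaler0 addr0.
Qed.

Lemma lowrankZ r (a : R) M : lowrank r M -> lowrank r (a *: M).
Proof.
move=> [sM rM]; split; last exact: leq_trans (mxrank_scale _ _) rM.
by rewrite -[a *: M]addr0 -(scale0r M); exact: symmetricmxL.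
Qed.

(** Truncating the approximation [N] to the block keeps it admissible and preserves its inner
    product with [block S M], while |N|^2 drops by |N - block S N|^2. Optimality makes this drop
    zero, however ties are broken. *)
Lemma lowrank_approx_block r (P : 'M[R]_n -> 'M[R]_n) S M :
  best_approx_operator (lowrank r) P ->
  block S (P (block S M)) = P (block S M).
Proof.
move=> PP; set N := P _.
have [[sN rN] _] := PP (block S M).
have bN : lowrank r (block S N).
  by split; [exact: symmetric_block|exact: leq_trans (rank_block _ _) rN].
have blockK U : block S (block S U) = block S U.
  by apply/matrixP => i j; rewrite !mxE; case: (_ && _).
have eM : frob_inner (block S M) (block S N) = frob_inner (block S M) N.
  by rewrite -frob_inner_block blockK.
have eN : frob_inner N (block S N) = frob_inner (block S N) (block S N).
  by rewrite frob_inner_block blockK.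
have := best_approx_sq PP (block S M) bN.
rewrite -/N !frob_inner_sqB eM => le.
apply/esym/eqP; rewrite -subr_eq0; apply/eqP/frob_norm_eq0/eqP.
rewrite -sqrf_eq0 frob_norm_sq eq_le frob_inner_ge0 andbT frob_inner_sqB.
lra.
Qed.

End SymmetricMatrices.

(** * Convergence of the iteration *)

Lemma frob_inner_cvg (R : realType) (n : nat) (X_ : nat -> 'M[R]_n)
    (X : 'M[R]_n) (c rho : R) : 0 <= rho < 1 ->
  (forall k, frob_inner (X - X_ k.+1) (X - X_ k.+1) <= c * rho ^+ k) ->
  X_ @ \oo --> X.
Proof.
move=> /andP[rho0 rho1] le.
rewrite -(cvg_shiftS X_); apply/cvg_ballP => e e0.
have /cvgrPdist_lt /(_ (e ^+ 2)) : c * rho ^+ k @[k --> \oo] --> (0 : R).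
  by apply: cvg_geometric; rewrite ger0_norm.
rewrite exprn_gt0 // => /(_ isT); apply: filterS => k.
rewrite sub0r normrN => small; split=> // i j.
rewrite -ball_normE /ball_ /= -(@ltr_pXn2r _ 2) ?nnegrE // ?ltW //.
rewrite real_normK ?num_real //.
(* Balls of matrices are entrywise, and each squared entry is at most the squared Frobenius norm. *)
have := frob_inner_ge_entry (X - X_ k.+1) i j; rewrite !mxE => ent.
rewrite (le_lt_trans ent) // (le_lt_trans (le k)) //.
by rewrite (le_lt_trans (ler_norm _)).
Qed.

(** This is the contraction before [T] acts, with [s] and [r] standing for the doubled parameters of
    the theorem. *)
Lemma head_step (R : realType) (n m r s r' s' : nat)
    (P2 Pr' H : 'M[R]_n -> 'M[R]_n) (cH : R)
    (A : {linear 'M[R]_n -> 'cV[R]_m}) (Astar : 'cV[R]_m -> 'M[R]_n)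
    (delta : R) (E : 'M[R]_n) :
  best_approx_operator (sparse_lowrank s r) P2 ->
  best_approx_operator (lowrank r') Pr' ->
  head_projection (sparse_lowrank s r) (sparse_lowrank s' r') P2 cH H ->
  (forall M : 'M[R]_n, exists S' : {set 'I_n},
    index_set_of_size s' S' /\ H M = Pr' (block S' M)) ->
  is_adjoint A Astar -> 0 < delta <= 1 ->
  restricted_isometry (sparse_lowrank (s + s') (r + r')) A delta ->
  sparse_lowrank s r E ->
  frob_inner (E - H (Astar (A E))) (E - H (Astar (A E))) <=
  (1 - cH ^+ 2 * (1 - delta) ^+ 2 + 2 * delta * (1 + delta)) * frob_inner E E.
Proof.
move=> hP2 hPr' [_ /andP[cH0 cH1] Hin Hhead] Hform adj /andP[d0 d1] rip SE.
set G := Astar _.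
have EH a b : sparse_lowrank (s + s') (r + r') (a *: E + b *: H G).
  exact: sparse_lowrankL.
have inner_GH : frob_inner (A E) (A (H G)) = frob_inner (H G) (H G).
  have [S' [_ HGE]] := Hform G.
  (* The adjoint gives <G, H G>; since [H G] lives on the block, [G] may be cut to [block S' G],
     where the cone identity applies. *)
  rewrite frob_innerC -adj -/G frob_innerC HGE.
  rewrite -(lowrank_approx_block _ _ hPr') -frob_inner_block.
  rewrite (lowrank_approx_block _ _ hPr').
  by apply: best_approx_cone => // a M; exact: lowrankZ.
have headE : cH * (1 - delta) * frob_norm E <= frob_norm (H G).
  apply: le_trans (Hhead G); rewrite -mulrA ler_pM2l //.
  have [/frob_norm_eq0 ->|E0] := eqVneq (frob_norm E) 0.
    by rewrite {1}/frob_norm frob_inner0l sqrtr0 mulr0 frob_norm_ge0.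
  have {}E0 : 0 < frob_norm E by rewrite lt_def E0 frob_norm_ge0.
  rewrite -(ler_pM2r E0).
  (* Here <G, E> = |A E|^2, which is at least (1 - delta) |E|^2. *)
  have := best_approx_inner_le hP2 (@sparse_lowrankZ _ _ _ _) G SE.
  apply: le_trans; rewrite frob_innerC adj -mulrA -expr2.
  have := EH 1 0; rewrite scale1r scale0r addr0 => /rip /andP[+ _].
  by rewrite !frob_norm_sq.
have := restricted_isometry_polar rip EH.
rewrite inner_GH frob_inner_sqB -!frob_norm_sq ler_norml => /andP[lo up].
have := frob_norm_ge0 E; have := frob_norm_ge0 (H G).
have CS := le_trans (ler_norm _) (@frob_cauchy_schwarz R n 0 E (H G)).
move: (frob_norm E) (frob_norm (H G)) (frob_inner E (H G)) headE lo up CS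
  => e h w headE lo up CS h0 e0.
(* From h^2 <= w + delta e h and w <= e h, divided by h. *)
have he : h <= (1 + delta) * e.
  have [->|hn0] := eqVneq h 0; first by rewrite mulr_ge0 // addr_ge0 // ltW.
  have {}h0 : 0 < h by rewrite lt_def hn0.
  by rewrite -(ler_pM2r h0); nra.
have sqh : cH ^+ 2 * (1 - delta) ^+ 2 * e ^+ 2 <= h ^+ 2.
  rewrite -!exprMn lerXn2r ?nnegrE // !mulr_ge0 ?subr_ge0 // ltW //.
have dehe : delta * (e * h) <= delta * (1 + delta) * e ^+ 2.
  by rewrite -mulrA ler_pM2l // expr2 mulrA [leRHS]mulrAC mulrC ler_wpM2r // mulrC.
(* With w >= h^2 - delta e h, the left side is at most e^2 - h^2 + 2 delta e h. *)
nra.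
Qed.

Theorem theorem6 (R : realType) (n m r s r' s' : nat)
    (hr : (1 <= r)%N) (hs : (1 <= s)%N) (hr' : (1 <= r')%N) (hs' : (1 <= s')%N)
    (P P2 Pr' : 'M[R]_n -> 'M[R]_n)
    (hP : best_approx_operator (sparse_lowrank s r) P)
    (hP2 : best_approx_operator (sparse_lowrank (2 * s) (2 * r)) P2)
    (hPr' : best_approx_operator (lowrank r') Pr')
    (T H : 'M[R]_n -> 'M[R]_n) (CT cH : R)
    (hT : tail_projection (sparse_lowrank s r) P CT T)
    (hH : head_projection (sparse_lowrank (2 * s) (2 * r))
            (sparse_lowrank s' r') P2 cH H)
    (hHform : forall M : 'M[R]_n, exists S' : {set 'I_n},
        index_set_of_size s' S' /\ H M = Pr' (block S' M))
    (A : {linear 'M[R]_n -> 'cV[R]_m})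
    (Astar : 'cV[R]_m -> 'M[R]_n) (hAstar : is_adjoint A Astar)
    (hCTcH : (1 + CT) ^+ 2 * (1 - cH ^+ 2) < 1)
    (delta : R) (hdelta : 0 < delta)
    (hRIP : restricted_isometry
              (sparse_lowrank (2 * s + s') (2 * r + r')) A delta)
    (hrho : (1 + CT) ^+ 2 *
              (1 - cH ^+ 2 * (1 - delta) ^+ 2 + 2 * delta * (1 + delta)) < 1)
    (X : 'M[R]_n) (hX : sparse_lowrank s r X)
    (y : 'cV[R]_m) (hy : y = A X)
    (X_ : nat -> 'M[R]_n)
    (hX_ : forall k : nat,
        X_ k.+1 = T (X_ k + H (Astar (y - A (X_ k))))) :
  X_ @ \oo --> X.
Proof.
have [CT1 Tin Tbest] := hT.
have [_ /andP[cH0 cH1] _ _] := hH.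
set b := 1 - _ + _ in hrho.
have CTsq : 4 <= (1 + CT) ^+ 2 by nra.
have cHsq : cH ^+ 2 <= 1 by nra.
have cHd : cH ^+ 2 * (1 - delta) ^+ 2 <= (1 - delta) ^+ 2.
  by rewrite ler_piMl ?sqr_ge0.
have b0 : 0 < b by rewrite /b; nra.
(* Smallness of [delta] follows from [hrho]: b >= 4 delta + delta^2 and 4 b < 1. *)
have d1 : delta <= 1.
  have : 4 * b < 1 by apply: le_lt_trans hrho; rewrite ler_wpM2r // ltW.
  rewrite /b; nra.
set rho := _ * b in hrho.
have rho0 : 0 <= rho by rewrite mulr_ge0 ?sqr_ge0 // ltW.
have step k : sparse_lowrank s r (X_ k) ->
  frob_inner (X - X_ k.+1) (X - X_ k.+1) <=
  rho * frob_inner (X - X_ k) (X - X_ k).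
  move=> Xk; pose E := X - X_ k.
  have SE : sparse_lowrank (2 * s) (2 * r) E.
    by have := sparse_lowrankL 1 (-1) hX Xk;
      rewrite scale1r scaleN1r !addnn -!mul2n.
  have := @head_step R n m _ _ _ _ _ _ _ cH A _ delta E hP2 hPr' hH hHform hAstar.
  rewrite hdelta d1 => /(_ isT hRIP SE).
  rewrite -/b hX_ hy -raddfB -/E; set W := H _ => hW.
  (* [X] itself competes with the best approximation of [X_ k + W], so the tail error is at most CT
     |E - W|. *)
  have tri : frob_norm (X - T (X_ k + W)) <= (1 + CT) * frob_norm (E - W).
    have -> : X - T (X_ k + W) = (E - W) + (X_ k + W - T (X_ k + W)).
      by rewrite /E -[X - X_ k - W]addrA -opprD subrKA.
    apply: le_trans (ler_frob_normD _ _) _.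
    rewrite mulrDl mul1r lerD2l; apply: le_trans (Tbest _) _.
    rewrite ler_wpM2l //; first by apply: le_trans CT1.
    have <- : frob_norm (X_ k + W - X) = frob_norm (E - W).
      by rewrite -frob_normN opprB opprD addrA.
    by have [_ ->] := hP (X_ k + W).
  rewrite /rho -mulrA.
  apply: (@le_trans _ _ ((1 + CT) ^+ 2 * frob_inner (E - W) (E - W))).
    rewrite -!frob_norm_sq -exprMn lerXn2r ?nnegrE ?frob_norm_ge0 //.
    by rewrite mulr_ge0 ?frob_norm_ge0 // addr_ge0 // (le_trans _ CT1).
  by rewrite ler_wpM2l ?sqr_ge0.
(* The decay is counted from [X_ 1], the first iterate sure to lie in the range of [T]; [X_ 0] is
   arbitrary. *)
apply: (@frob_inner_cvg _ _ _ _ (frob_inner (X - X_ 1) (X - X_ 1)) rho).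
  by rewrite rho0 hrho.
elim=> [|k IH]; first by rewrite expr0 mulr1.
apply: le_trans (step _ _) _; first by rewrite hX_; exact: Tin.
by rewrite exprS mulrCA ler_wpM2l.
Qed.
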